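(* Let $p,l\ge1$ be integers, $W\in\mathbb{R}^{p\times p}$, $L\in\mathbb{R}^{p\times l}$, $\bm{f}:\mathbb{R}^l\to\mathbb{R}^l$, and let $\bm{u}:[0,+\infty)\to\mathbb{R}^p$, $\bm{x}:[0,+\infty)\to\mathbb{R}^l$ be a solution of $$\dot{\bm{u}}(t)=W\bm{u}(t)+L\bm{f}(\bm{x}(t)),\qquad \dot{\bm{x}}(t)=L^T\bm{u}(t).$$ Then there exist an orthogonal matrix $P\in\mathbb{R}^{p\times p}$, a diagonal matrix $D\in\mathbb{R}^{p\times p}$, a skew-symmetric matrix $S\in\mathbb{R}^{p\times p}$ and a matrix $R\in\mathbb{R}^{p\times l}$ such that $\bm{z}(t):=P^T\bm{u}(t)$ and $\bm{x}(t)$ solve the system $$\dot{\bm{z}}(t)=(D+S)\bm{z}(t)+R\bm{f}(\bm{x}(t)),\qquad \dot{\bm{x}}(t)=R^T\bm{z}(t).$$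
   Context: All matrices are real and constant in time. A matrix $S$ is skew-symmetric if $S^T=-S$. *)

(* Defs.v *)
From mathcomp Require Import all_boot all_order all_algebra.
From mathcomp Require Import all_classical all_reals all_analysis.
Import Order.TTheory GRing.Theory Num.Theory.
Import numFieldNormedType.Exports.

Set Implicit Arguments.
Unset Strict Implicit.
Unset Printing Implicit Defensive.

Local Open Scope classical_set_scope.
Local Open Scope ring_scope.

(* Derivative relative to D: only points of D enter the difference quotient.
   For D = `[0, +oo[ it is two-sided at t > 0 and one-sided at t = 0. *)
Definition has_derivative_within (R : realType) (V : normedModType R)
    (D : set R) (u : R -> V) (t : R) (v : V) : Prop :=
  (s - t)^-1 *: (u s - u t) @[s --> within D t^'] --> v.

(* Curves on [0, +oo) are total functions on R whose values at negative times
   play no role. *)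
Definition is_solution (R : realType) (p l : nat)
    (A : 'M[R]_p) (B : 'M[R]_(p, l)) (f : 'cV[R]_l -> 'cV[R]_l)
    (u : R -> 'cV[R]_p) (x : R -> 'cV[R]_l) : Prop :=
  forall t : R, 0 <= t ->
    has_derivative_within `[0, +oo[ u t (A *m u t + B *m f (x t)) /\
    has_derivative_within `[0, +oo[ x t (B^T *m u t).

Definition orthogonal_mx (R : realType) (n : nat) (P : 'M[R]_n) : Prop :=
  P^T *m P = 1%:M.

Definition skew_symmetric_mx (R : realType) (n : nat) (S : 'M[R]_n) : Prop :=
  S^T = - S.

(* Main.v *)
(* Split W into its symmetric part A and its skew-symmetric part K, and let P
   be an orthogonal matrix diagonalizing A. Then P^T W P is the sum of the
   diagonal matrix P^T A P and the skew-symmetric matrix P^T K P, and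
   z = P^T u, R = P^T L do the job since P P^T = 1.
   The real spectral theorem for A goes by induction on the dimension: the
   complex spectral theorem yields a real eigenvalue, and a Householder
   reflection sending e_0 to a unit eigenvector splits off a 1x1 block. *)
Require Import Defs.
From mathcomp Require Import all_boot all_order all_algebra.
From mathcomp Require Import all_classical all_reals all_analysis.
From mathcomp Require Import complex.
Import Order.TTheory GRing.Theory Num.Theory.
Import numFieldNormedType.Exports.

Local Open Scope ring_scope.

(** Over [F[i]] the matrix becomes Hermitian, so its spectral values are real; a real root of its
    characteristic polynomial is already a root over [F]. *)
Lemma symmetric_eigenvalue_exists {F : rcfType} {n : nat} {A : 'M[F]_n.+1} :
  A^T = A -> exists a, eigenvalue A a.
Proof.
move=> symA; set AC := map_mx (fun a : F => a%:C%C) A.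
have hermAC : AC \is hermsymmx.
  apply: realsym_hermsym; last first.
    by apply/mxOverP => i j; rewrite mxE; apply/complex_realP; exists (A i j).
  by apply/is_hermitianmxP; rewrite expr0 scale1r map_mx_id // map_trmx symA.
have := hermitian_normalmx hermAC => /orthomx_spectralP.
have := spectral_unit AC; have := hermitian_spectral_diag_real hermAC.
set P := spectralmx AC; set d := spectral_diag AC.
move=> /mxOverP /(_ 0 0) /complex_realP[a d00E] Punit ACE.
exists a; rewrite eigenvalue_root_char -(fmorph_root (real_complex F)).
rewrite map_char_poly -eigenvalue_root_char; apply/eigenvalueP.
(* From [P *m AC = diag_mx d *m P], the rows of [P] are left eigenvectors; they are nonzero because
   [P] is invertible. *)
exists (row 0 P); last first.
  have := row_free_unit P; rewrite Punit => /row_freeP[Q PQ].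
  apply/eqP => P0; have /rowP/(_ 0) := congr1 (row 0) PQ.
  by rewrite row_mul P0 mul0mx !mxE => /esym/eqP; rewrite oner_eq0.
rewrite -row_mul [map_mx _ _]ACE !mulmxA mulmxV // mul1mx.
by rewrite row_mul row_diag_mx -scalemxAl -rowE d00E.
Qed.

Lemma orthogonal_mxM {R : realType} {n : nat} {P Q : 'M[R]_n} :
  orthogonal_mx P -> orthogonal_mx Q -> orthogonal_mx (P *m Q).
Proof.
rewrite /orthogonal_mx => PP QQ.
by rewrite trmx_mul mulmxA -(mulmxA Q^T) PP mulmx1.
Qed.

Lemma mulmx_tr_eq0 {F : realDomainType} {n : nat} (w : 'rV[F]_n) :
  (w *m w^T == 0) = (w == 0).
Proof.
apply/eqP/eqP => [/rowP/(_ 0)|->]; last by rewrite mul0mx.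
rewrite !mxE => /eqP; rewrite psumr_eq0; last first.
  by move=> i _; rewrite mxE -expr2 sqr_ge0.
move=> /allP w0; apply/rowP => i; apply/eqP; rewrite mxE.
by have := w0 i (mem_index_enum i); rewrite mxE mulf_eq0 orbb.
Qed.

(* H is the Householder reflection along e - v. *)
Lemma orthogonal_mx_exchange {R : realType} {n : nat} {v e : 'rV[R]_n} :
  v *m v^T = 1%:M -> e *m e^T = 1%:M ->
  exists H : 'M[R]_n, [/\ orthogonal_mx H, H^T = H & e *m H = v].
Proof.
move=> vv ee; have [->|ev] := eqVneq v e.
  by exists 1%:M; split; rewrite /orthogonal_mx ?trmx1 ?mulmx1.
set w := e - v; set c := (w *m w^T) 0 0.
have wwE : w *m w^T = c%:M by rewrite [LHS]mx11_scalar.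
have c_neq0 : c != 0.
  apply: contra ev => /eqP c0; rewrite eq_sym -subr_eq0 -mulmx_tr_eq0 -/w wwE c0.
  by rewrite raddf0.
have ve : v *m e^T = e *m v^T.
  apply/matrixP => i j; rewrite !ord1 !mxE.
  by apply: eq_bigr => k _; rewrite !mxE mulrC.
(* As [e] and [v] are unit vectors, [c = |e - v|^2 = 2 - 2 <e, v> = 2 <e, w>]; hence [e *m N = w]
   below, and the reflection sends [e] to [e - w = v]. *)
have ewE : 2 *: (e *m w^T) = c%:M.
  rewrite -wwE linearB /= mulmxBl !mulmxBr ee vv ve.
  by rewrite opprB scaler_nat mulr2n.
set N := (2 / c) *: (w^T *m w).
have NT : N^T = N by rewrite linearZ /= trmx_mul trmxK.
(* [N] is twice the orthogonal projection onto the line of [w], which makes [1 - N] an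
   involution. *)
have NN : N *m N = N + N.
  rewrite /N -scalemxAl -scalemxAr mulmxA -(mulmxA _ w w^T) wwE mul_mx_scalar.
  rewrite -scalemxAl 2!scalerA -mulrA divfK // -scalerA scalerDl scale1r.
  by rewrite [c^-1 * 2]mulrC.
have HT : (1%:M - N)^T = 1%:M - N by rewrite linearB /= trmx1 NT.
exists (1%:M - N); split=> //; rewrite /orthogonal_mx.
  rewrite HT mulmxBl mul1mx mulmxBr mulmx1 NN.
  by rewrite opprB addrK subrK.
rewrite mulmxBr mulmx1 -scalemxAr mulmxA mulrC -scalerA scalemxAl ewE.
by rewrite mul_scalar_mx scalerA mulVf // scale1r /w opprB addrC subrK.
Qed.

Lemma orthogonal_diagonalization {R : realType} {n : nat} {A : 'M[R]_n} :
  A^T = A -> exists2 P, orthogonal_mx P & is_diag_mx (P^T *m A *m P).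
Proof.
elim: n A => [|n IHn] A symA.
  by exists 1%:M; [rewrite /orthogonal_mx trmx1 mulmx1 | apply/is_diag_mxP => -[]].
have [a /eigenvalueP[v0 v0A v0_neq0]] := symmetric_eigenvalue_exists symA.
have [v vA vv] : exists2 v : 'rV[R]_n.+1, v *m A = a *: v & v *m v^T = 1%:M.
  set c := (v0 *m v0^T) 0 0.
  have c_gt0 : 0 < c.
    rewrite lt0r; apply/andP; split.
      apply: contra v0_neq0 => /eqP c0.
      by rewrite -mulmx_tr_eq0 [_ *m _]mx11_scalar -/c c0 raddf0.
    by rewrite /c mxE sumr_ge0 // => i _; rewrite mxE -expr2 sqr_ge0.
  exists ((Num.sqrt c)^-1 *: v0).
    by rewrite -scalemxAl v0A !scalerA mulrC.
  rewrite linearZ /= -scalemxAl -scalemxAr scalerA [_ *m _]mx11_scalar -/c.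
  rewrite scale_scalar_mx -invfM -expr2 sqr_sqrtr ?(ltW c_gt0) // mulVf //.
  by rewrite gt_eqF.
have ee : (delta_mx 0 0 : 'rV[R]_n.+1) *m (delta_mx 0 0)^T = 1%:M.
  by rewrite trmx_delta mul_delta_mx; apply/matrixP => i j; rewrite !mxE !ord1.
have [H [HH HT eH]] := orthogonal_mx_exchange vv ee.
(* The type ['M_(1 + n)] gives access to the blocks of the conjugated matrix. *)
have [B BE] : exists B : 'M[R]_(1 + n), H *m A *m H = B by exists (H *m A *m H).
have symB : B^T = B by rewrite -BE !trmx_mul HT symA mulmxA.
(* With [e] the first basis vector, [e H A H = v A H = a v H = a e]. Symmetry then clears the first
   column as well. *)
have B0 : row 0 B = a *: delta_mx 0 0.
  by rewrite -BE rowE !mulmxA eH vA -scalemxAl -eH -mulmxA -{1}HT HH mulmx1.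
have Bur : ursubmx B = 0.
  apply/rowP => j; have /rowP/(_ (rshift 1 j)) := B0.
  by rewrite !mxE /= mulr0 => <-; congr (B _ _); exact/val_inj.
have Bdl : dlsubmx B = 0 by rewrite -[LHS]trmxK trmx_dlsub symB Bur trmx0.
have [Q QQ diagQ] := IHn (drsubmx B) (etrans (trmx_drsub B) (congr1 drsubmx symB)).
pose Q1 : 'M[R]_(1 + n) := block_mx 1%:M 0 0 Q.
have Q1T : Q1^T = block_mx 1%:M 0 0 Q^T by rewrite tr_block_mx trmx1 !trmx0.
have Q1Q1 : Q1^T *m Q1 = 1%:M.
  rewrite Q1T mulmx_block QQ !(mulmx0, mul0mx, mulmx1, addr0, add0r).
  by rewrite -scalar_mx_block.
have Q1B : Q1^T *m B *m Q1 = block_mx (ulsubmx B) 0 0 (Q^T *m drsubmx B *m Q).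
  rewrite Q1T -[in LHS](submxK B) Bur Bdl !mulmx_block.
  by rewrite !(mulmx0, mul0mx, mul1mx, mulmx1, addr0, add0r).
have diagB : is_diag_mx (Q1^T *m B *m Q1).
  rewrite Q1B is_diag_block_mx // !eqxx diagQ andbT /=.
  by apply/is_diag_mxP => i j; rewrite !ord1.
exists (H *m Q1); first exact: orthogonal_mxM.
by rewrite trmx_mul HT !mulmxA -(mulmxA Q1^T) -(mulmxA Q1^T) BE.
Qed.

(** The product is a finite sum of coordinates of [M] times constant matrices, and coordinates are
    continuous. *)
Lemma mulmx_continuous {R : realType} {m n p : nat} (A : 'M[R]_(m, n)) :
  continuous (fun M : 'M[R]_(n, p) => A *m M).
Proof.
have -> : (fun M : 'M[R]_(n, p) => A *m M) =
    (fun M : 'M[R]_(n, p) => \sum_i \sum_j M i j *: (A *m delta_mx i j)).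
  apply/funext => M; rewrite {1}[M]matrix_sum_delta mulmx_sumr.
  apply: eq_bigr => i _; rewrite mulmx_sumr.
  by apply: eq_bigr => j _; rewrite scalemxAr.
move=> M; apply: cvg_big => [||i _]; first exact: add_continuous.
  exact: nbhs_filter.
apply: cvg_big => [||j _]; first exact: add_continuous.
  exact: nbhs_filter.
have Mij : {for M, continuous (fun M' : 'M[R]_(n, p) => M' i j)}.
  exact: coord_continuous.
exact: cvgZr_tmp Mij.
Qed.

(** By linearity [A] commutes with the difference quotient, and by continuity with its limit. *)
Lemma has_derivative_within_mulmx {R : realType} {m n : nat} (A : 'M[R]_(m, n))
    (D : set R) (u : R -> 'cV[R]_n) (t : R) (v : 'cV[R]_n) :
  has_derivative_within D u t v ->
  has_derivative_within D (fun s => A *m u s) t (A *m v).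
Proof.
rewrite /has_derivative_within => uv.
have -> : (fun s => (s - t)^-1 *: (A *m u s - A *m u t)) =
    mulmx A \o (fun s => (s - t)^-1 *: (u s - u t)).
  by apply/funext => s /=; rewrite -mulmxBr scalemxAr.
exact: (@cvg_comp _ _ _ _ (mulmx A) _ _ _ uv (mulmx_continuous A v)).
Qed.

Theorem theorem2 (R : realType) (p l : nat) (hp : (1 <= p)%N) (hl : (1 <= l)%N)
    (W : 'M[R]_p) (L : 'M[R]_(p, l)) (f : 'cV[R]_l -> 'cV[R]_l)
    (u : R -> 'cV[R]_p) (x : R -> 'cV[R]_l)
    (hux : is_solution W L f u x) :
  exists (P D S : 'M[R]_p) (Rm : 'M[R]_(p, l)),
    [/\ orthogonal_mx P, is_diag_mx D, skew_symmetric_mx S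
      & is_solution (D + S) Rm f (fun t => P^T *m u t) x].
Proof.
have symA : (2^-1 *: (W + W^T))^T = 2^-1 *: (W + W^T).
  by rewrite linearZ /= linearD /= trmxK addrC.
have [P PP diagP] := orthogonal_diagonalization symA.
have PPT : P *m P^T = 1%:M := mulmx1C PP.
pose K := 2^-1 *: (W - W^T).
have KT : K^T = - K by rewrite linearZ /= linearB /= trmxK -scalerN opprB.
have WE : 2^-1 *: (W + W^T) + K = W.
  rewrite -scalerDr addrACA subrr addr0 -mulr2n -(scaler_nat 2 W) scalerA.
  by rewrite mulVf ?scale1r // pnatr_eq0.
exists P, (P^T *m (2^-1 *: (W + W^T)) *m P), (P^T *m K *m P), (P^T *m L).
split=> //.
  by rewrite /skew_symmetric_mx !trmx_mul trmxK KT mulNmx mulmxN mulmxA.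
move=> t t_ge0; have [ut xt] := hux t t_ge0; split.
  (* Since [P P^T = 1], [(D + S) P^T u = P^T W u]: the new right-hand side is [P^T] times the old
     one. *)
  rewrite -mulmxDl -mulmxDr WE !mulmxA -(mulmxA (P^T *m W)) PPT mulmx1.
  by rewrite -!mulmxA -mulmxDr; exact: has_derivative_within_mulmx.
(* Here [R^T z = L^T P P^T u = L^T u], so the equation for [x] is unchanged. *)
by rewrite trmx_mul trmxK mulmxA -(mulmxA L^T) PPT mulmx1.
Qed.
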